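(* Let $(X,\mathcal{K})$ be a pair that satisfies $(A0')$ and $(A1)$. For a function $f:X\rightarrow\overline{\mathcal{K}}$ the following statements are equivalent: 1°. $f$ is anti-topical. 2°. $f(\inf X)=\top$ and $f(x)\otimes(x/y)\leq f(y)$ for all $x,y\in X$. 3°. $f(\inf X)=\top$ and $f(x)\otimes s_{y,d}(x)\leq f(y)$ for all $x,y\in X$ and all $d\in\overline{\mathcal{K}}$. 4°. $f(\inf X)=\top$ and $f(y)/(x/y)\geq f(x)$ for all $x,y\in X$ (the outer $/$ being residuation in $\overline{\mathcal{K}}$).
   Context: $(A0')$: $\mathcal{K}=(\mathcal{K},\oplus,\otimes)$ is a $b$-complete idempotent semifield, i.e. a semiring with idempotent addition, with zero $\varepsilon$ (neutral for $\oplus$, absorbing for $\otimes$) and unit $e$, in which every $\mu\neq\varepsilon$ is invertible for $\otimes$, ordered by $\lambda\leq\mu\Leftrightarrow\lambda\oplus\mu=\mu$, such that every subset bounded from above has a supremum (its sum) in $\mathcal{K}$ and $\otimes$ distributes over such suprema (such a $\mathcal{K}$ is commutative); and $X$ is a $b$-complete idempotent semimodule over $\mathcal{K}$: a semimodule with idempotent addition, ordered by $x\leq y\Leftrightarrow x\oplus y=y$, in which every subset bounded from above has a supremum (its sum), and the action $(\lambda,x)\mapsto\lambda x$ distributes over suprema of bounded-above sets of scalars and of vectors. Its zero is $\inf X$; thus $\varepsilon x=\inf X$ for $x\in X$ and $\lambda\inf X=\inf X$ for $\lambda\in\mathcal{K}$. $(A1)$: for all $x\in X$, $y\in X\setminus\{\inf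 X\}$ the set $\{\lambda\in\mathcal{K}:\lambda y\leq x\}$ is bounded from above in $\mathcal{K}$. It is assumed throughout that $\mathcal{K}$ has no greatest element. Minimal enlargement: $\overline{\mathcal{K}}=\mathcal{K}\cup\{\top\}$, with $\top\notin\mathcal{K}$, $\alpha\leq\top$ and $\alpha\oplus\top=\top$ for all $\alpha\in\overline{\mathcal{K}}$. The product $\otimes$ (also written by concatenation) is extended by $\alpha\otimes\top=\top\otimes\alpha=\top$ for $\alpha\in\overline{\mathcal{K}}\setminus\{\varepsilon\}$ and $\alpha\otimes\varepsilon=\varepsilon\otimes\alpha=\varepsilon$ for $\alpha\in\overline{\mathcal{K}}$. A second product $\dot{\otimes}$ is defined by $\alpha\dot{\otimes}\beta=\alpha\otimes\beta$ for $\alpha,\beta\in\mathcal{K}$, and $\alpha\dot{\otimes}\top=\top\dot{\otimes}\alpha=\top$ for $\alpha\in\overline{\mathcal{K}}$. Conventions: $\varepsilon^{-1}=\top$, $\top^{-1}=\varepsilon$. Suprema and infima of values are taken in $\overline{\mathcal{K}}$. Extended residuation: $x/y:=\sup\{\lambda\in\mathcal{K}:\lambda y\leq x\}\in\overline{\mathcal{K}}$ for all $x,y\in X$ (so $x/\inf X=\top$). Residuation in $\overline{\mathcal{K}}$: $\lambda/\mu:=\sup\{\nu\in\mathcal{K}:\mu\otimes\nu\leq\lambda\}\in\overline{\mathcal{K}}$ for $\lambda,\mu\in\overline{\mathcal{K}}$. A function $f:X\to\overline{\mathcal{K}}$ is anti-topical if it is decreasing ($x'\leq x''\Rightarrow f(x')\geq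 f(x'')$) and anti-homogeneous ($f(\lambda x)=\lambda^{-1}\dot{\otimes}f(x)$ for all $x\in X,\lambda\in\mathcal{K}$). For $x,y\in X$, $d\in\overline{\mathcal{K}}$: $s_{y,d}(x):=\inf\{x/y,d\}$. *)

(* Defs.v *)
From HB Require Import structures.
From mathcomp Require Import all_boot all_order all_algebra.
From mathcomp Require Import boolp classical_sets.

Set Implicit Arguments.
Unset Strict Implicit.
Unset Printing Implicit Defensive.

Import Order.TTheory GRing.Theory Num.Theory.
Local Open Scope classical_set_scope.
Local Open Scope ring_scope.

HB.mixin Record isIdempotentNmodule V of GRing.Nmodule V := {
  addxx : forall x : V, x + x = x
}.

#[short(type="idemNmodType")]
HB.structure Definition IdemNmodule :=
  {V of GRing.Nmodule V & isIdempotentNmodule V}.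

Definition nle (V : idemNmodType) (x y : V) : bool := x + y == y.
Notation "x <=+ y" := (nle x y) (at level 70, no associativity) : ring_scope.

(* The alias [addorder V] of [V] carries the order [<=+] as a partial order, so
   that the bounds and suprema of classical_sets apply to subsets of [V]. *)
Definition addorder (V : idemNmodType) : Type := V.

Section AddOrder.
Variable V : idemNmodType.

Lemma nle_refl : reflexive (@nle V).
Proof. by move=> x; rewrite /nle addxx. Qed.

Lemma nle_anti : antisymmetric (@nle V).
Proof. by move=> x y /andP[/eqP xy /eqP yx]; rewrite -xy -{1}yx addrC. Qed.

Lemma nle_trans : transitive (@nle V).
Proof.
by move=> y x z /eqP xy /eqP yz; apply/eqP; rewrite -yz addrA xy.
Qed.

HB.instance Definition _ := Choice.copy (addorder V) (V : Type).
HB.instance Definition _ :=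
  Order.Le_isPOrder.Build ring_display (addorder V)
    nle_refl nle_anti nle_trans.

End AddOrder.

HB.mixin Record isBComplete V of IdemNmodule V := {
  bcomplete : forall A : set (addorder V), has_ubound A -> supremums A !=set0
}.

#[short(type="bcIdempotentType")]
HB.structure Definition BCIdempotent := {V of IdemNmodule V & isBComplete V}.

Definition nsup (V : idemNmodType) (A : set V) (s : V) : Prop :=
  supremums (A : set (addorder V)) s.

(* Multiplication is not assumed commutative: commutativity follows from the
   axioms (Iwasawa's theorem on conditionally complete lattice-ordered groups).
   The value [sinv 0] is unspecified, and is never used. *)
HB.mixin Record isBCompleteSemifield K of
    GRing.PzSemiRing K & BCIdempotent K := {
  sinv : K -> K;
  mulVs : forall a : K, a != 0 -> sinv a * a = 1;
  mulsV : forall a : K, a != 0 -> a * sinv a = 1;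
  mul_supr : forall (a u : K) (A : set K),
    nsup A u -> nsup [set a * b | b in A] (a * u);
  mul_supl : forall (a u : K) (A : set K),
    nsup A u -> nsup [set b * a | b in A] (u * a)
}.

#[short(type="bcSemifieldType")]
HB.structure Definition BCSemifield :=
  {K of GRing.PzSemiRing K & BCIdempotent K & isBCompleteSemifield K}.

HB.mixin Record isBCompleteSemimodule (K : bcSemifieldType) X of
    GRing.LSemiModule K X & BCIdempotent X := {
  scale_supr : forall (l : K) (u : X) (A : set X),
    nsup A u -> nsup [set l *: x | x in A] (l *: u);
  scale_supl : forall (u : K) (x : X) (L : set K),
    nsup L u -> nsup [set l *: x | l in L] (u *: x)
}.

#[short(type="bcSemimodType")]
HB.structure Definition BCSemimodule (K : bcSemifieldType) :=
  {X of GRing.LSemiModule K X & BCIdempotent X & isBCompleteSemimodule K X}.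

(* The zero of an idempotent semimodule is its least element: inf X is [0]. *)
Lemma bc_le0x (V : bcIdempotentType) (x : V) : 0 <=+ x.
Proof. by rewrite /nle add0r. Qed.

Lemma bc_inf_setT (V : bcIdempotentType) (x0 : V) :
  infimum (x0 : addorder V) [set: addorder V] = 0.
Proof.
have inf0 : infimums [set: addorder V] 0.
  by split=> [x _|y yT]; [exact: bc_le0x | exact: yT].
rewrite /infimum; case: ifPn => [/eqP T0|_].
  by have : [set: addorder V] 0 by []; rewrite T0.
by case: xgetP => [y _ yinf|/(_ _ inf0)//]; apply: (is_subset1_infimums yinf).
Qed.

(* The minimal enlargement of K by a top element. *)
Inductive enlarged (K : Type) : Type := Fin of K | Top.
Arguments Fin {K} _.
Arguments Top {K}.

Section EnlargedOrder.
Variable K : idemNmodType.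

Definition option_of_enlarged (a : enlarged K) : option K :=
  if a is Fin x then Some x else None.
Definition enlarged_of_option (a : option K) : enlarged K :=
  if a is Some x then Fin x else Top.
Lemma option_of_enlargedK : cancel option_of_enlarged enlarged_of_option.
Proof. by case. Qed.

HB.instance Definition _ :=
  Choice.copy (enlarged K) (can_type option_of_enlargedK).

Definition le_enlarged (a b : enlarged K) : bool :=
  match a, b with
  | _, Top => true
  | Fin x, Fin y => x <=+ y
  | Top, Fin _ => false
  end.

Lemma le_enlarged_refl : reflexive le_enlarged.
Proof. by case=> //= x; exact: nle_refl. Qed.

Lemma le_enlarged_anti : antisymmetric le_enlarged.
Proof. by case=> [x|] [y|] //= /nle_anti ->. Qed.

Lemma le_enlarged_trans : transitive le_enlarged.
Proof. by case=> [y|] [x|] [z|] //=; exact: nle_trans. Qed.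

HB.instance Definition _ :=
  Order.Le_isPOrder.Build ring_display (enlarged K)
    le_enlarged_refl le_enlarged_anti le_enlarged_trans.

End EnlargedOrder.

Section Topical.
Variable K : bcSemifieldType.

Definition esup (A : set (enlarged K)) : enlarged K := supremum (Fin 0) A.
Definition einf (A : set (enlarged K)) : enlarged K := infimum Top A.

(* The product with 0 * Top = 0. *)
Definition emul (a b : enlarged K) : enlarged K :=
  match a, b with
  | Fin x, Fin y => Fin (x * y)
  | Fin x, Top => if x == 0 then Fin 0 else Top
  | Top, Fin y => if y == 0 then Fin 0 else Top
  | Top, Top => Top
  end.

(* The dotted product, with 0 * Top = Top. *)
Definition edmul (a b : enlarged K) : enlarged K :=
  match a, b with
  | Fin x, Fin y => Fin (x * y)
  | _, _ => Top
  end.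

Definition einv (a : enlarged K) : enlarged K :=
  match a with
  | Fin x => if x == 0 then Top else Fin (sinv x)
  | Top => Fin 0
  end.

Definition eresid (a b : enlarged K) : enlarged K :=
  esup [set Fin c | c in [set c : K | emul b (Fin c) <= a]].

Variable X : bcSemimodType K.

Definition resid (x y : X) : enlarged K :=
  esup [set Fin l | l in [set l : K | l *: y <=+ x]].

Definition elementary (y : X) (d : enlarged K) (x : X) : enlarged K :=
  einf [set resid x y; d].

Definition anti_topical (f : X -> enlarged K) : Prop :=
  (forall x1 x2 : X, x1 <=+ x2 -> f x2 <= f x1) /\
  (forall (l : K) (x : X), f (l *: x) = edmul (einv (Fin l)) (f x)).

Definition residuals_bounded : Prop :=
  forall x y : X, y != 0 -> has_ubound [set l : addorder K | l *: y <=+ x].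

End Topical.

Arguments residuals_bounded {K} X.

(* Main.v *)
(** The equivalences are the Galois connection of residuation: [l y <= x] gives
    [f x <= f (l y) = l^-1 f y], that is [l f(x) <= f y], and the supremum over
    [l] is attained.  To pass to [f(x) l <= f y] one needs [K] commutative,
    which the axioms do not state.  The nonzero elements of [K] form an
    Archimedean lattice-ordered group, and such a group is abelian: working
    modulo the polar of an element [g] one may assume any two given elements comparable, as in a
    totally ordered group.  There, for [t >= 1], sandwiching [t^n] between
    consecutive powers of [y = |x|], which commutes with [x], yields
    [t^n <= y c^n] and [t^n <= c^n y] for [c = x^-1 t x].  If [t c <= c t] then
    [(t c^-1)^n <= t^n c^-n <= y] for all [n], and otherwise
    [(c^-1 t)^n <= c^-n t^n <= y]; so [t <= c] either way. *)
Require Import Defs.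
From HB Require Import structures.
From mathcomp Require Import all_boot all_order all_algebra.
From mathcomp Require Import boolp classical_sets.
Import Order.TTheory GRing.Theory Num.Theory.

(** * Lattice-ordered groups: positive parts and orthogonality *)

HB.mixin Record isTranslationInvariant (d : Order.disp_t) G
    of monoid.Group G & Order.Lattice d G := {
  lemul2l : forall z x y : G, (x <= y)%O -> (z * x <= z * y)%O%g;
  lemul2r : forall z x y : G, (x <= y)%O -> (x * z <= y * z)%O%g
}.

#[short(type="lgroupType")]
HB.structure Definition LGroup (d : Order.disp_t) :=
  {G of monoid.Group G & Order.Lattice d G & isTranslationInvariant d G}.

Section LGroupTheory.
Context {d : Order.disp_t} {G : lgroupType d}.
Implicit Types (a b c g h t u v w x y z : G) (n : nat).
Local Open Scope order_scope.
Local Open Scope group_scope.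

Lemma lemul x y z t : x <= y -> z <= t -> x * z <= y * t.
Proof. by move=> xy zt; apply: le_trans (lemul2l y _ _ zt); apply: lemul2r. Qed.

Lemma mul_ge1 x y : 1 <= x -> 1 <= y -> 1 <= x * y.
Proof. by move=> x1 y1; rewrite -[1]mulg1; apply: lemul. Qed.

Lemma exp_ge1 x n : 1 <= x -> 1 <= x ^+ n.
Proof.
by move=> x1; elim: n => [|n IHn]; rewrite ?expg0 // expgS; apply: mul_ge1.
Qed.

Lemma leexp x y n : x <= y -> x ^+ n <= y ^+ n.
Proof.
by move=> xy; elim: n => [|n IHn]; rewrite ?expg0 // !expgS; apply: lemul.
Qed.

Lemma leinv x y : x <= y -> y^-1 <= x^-1.
Proof.
move=> /(lemul2l x^-1)/(lemul2r y^-1).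
by rewrite mulVg mul1g mulgK.
Qed.

Lemma mulgIr z x y : z * (x `&` y) = (z * x) `&` (z * y).
Proof.
apply/le_anti/andP; split.
  by rewrite lexI !lemul2l ?leIl ?leIr.
have : z^-1 * ((z * x) `&` (z * y)) <= x `&` y.
  rewrite lexI; apply/andP; split.
    by rewrite -[X in _ <= X](mulKg z); apply: lemul2l; apply: leIl.
  by rewrite -[X in _ <= X](mulKg z); apply: lemul2l; apply: leIr.
by move=> /(lemul2l z); rewrite mulVKg.
Qed.

Lemma mulgIl z x y : (x `&` y) * z = (x * z) `&` (y * z).
Proof.
apply/le_anti/andP; split.
  by rewrite lexI !lemul2r ?leIl ?leIr.
have : ((x * z) `&` (y * z)) * z^-1 <= x `&` y.
  rewrite lexI; apply/andP; split.
    by rewrite -[X in _ <= X](mulgK z); apply: lemul2r; apply: leIl.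
  by rewrite -[X in _ <= X](mulgK z); apply: lemul2r; apply: leIr.
by move=> /(lemul2r z); rewrite mulgVK.
Qed.

Lemma mulgUr z x y : z * (x `|` y) = (z * x) `|` (z * y).
Proof.
apply/le_anti/andP; split; last by rewrite leUx !lemul2l ?leUl ?leUr.
have : x `|` y <= z^-1 * ((z * x) `|` (z * y)).
  rewrite leUx; apply/andP; split.
    by rewrite -[X in X <= _](mulKg z); apply: lemul2l; apply: leUl.
  by rewrite -[X in X <= _](mulKg z); apply: lemul2l; apply: leUr.
by move=> /(lemul2l z); rewrite mulVKg.
Qed.

Lemma leconj c x y : x <= y -> x ^ c <= y ^ c.
Proof. by move=> xy; rewrite !conjgE; apply/lemul2l/lemul2r. Qed.

Lemma conj_ge1 c x : 1 <= x -> 1 <= x ^ c.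
Proof. by move=> /(leconj c); rewrite conj1g. Qed.

Lemma conjI c x y : (x `&` y) ^ c = x ^ c `&` y ^ c.
Proof. by rewrite !conjgE mulgIl mulgIr. Qed.

Definition pospart x := x `|` 1.

Lemma le_pospart x : x <= pospart x. Proof. exact: leUl. Qed.
Lemma pospart_ge1 x : 1 <= pospart x. Proof. exact: leUr. Qed.
Hint Resolve le_pospart pospart_ge1 : core.

Lemma pospart_le1 x : x <= 1 -> pospart x = 1.
Proof. by move=> x1; apply: join_r. Qed.

Lemma pospart_leM x y : pospart (x * y) <= pospart x * pospart y.
Proof. by rewrite leUx mul_ge1 // lemul. Qed.

Lemma pospartV x : pospart x^-1 = x^-1 * pospart x.
Proof. by rewrite /pospart mulgUr mulVg mulg1 joinC. Qed.

Lemma pospart_div x : x = pospart x * (pospart x^-1)^-1.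
Proof. by rewrite pospartV invgM invgK mulVKg. Qed.

Lemma pospartJ c x : pospart x ^ c = pospart (x ^ c).
Proof.
apply/le_anti/andP; split.
  rewrite -[X in _ <= X](conjgKV c); apply: leconj; rewrite leUx.
  rewrite -{1}[x](conjgK c) leconj //=.
  by rewrite -(conj1g c^-1); apply: leconj.
by rewrite leUx leconj //= conj_ge1.
Qed.

Definition orth x y := x `&` y = 1.

Lemma orthC x y : orth x y -> orth y x.
Proof. by rewrite /orth meetC. Qed.

Lemma orth_le x y z : 1 <= x -> x <= y -> orth y z -> 1 <= z -> orth x z.
Proof.
move=> x1 xy yz z1; apply/le_anti/andP; split; last by rewrite lexI x1.
by rewrite -yz leI2.
Qed.

(** Since [pospart x^-1] is [x^-1 * pospart x], the factor [pospart x] comes out of the meet on the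
    right and leaves the meet of [1] and [x^-1], which is its inverse. *)
Lemma orth_pospartV x : orth (pospart x) (pospart x^-1).
Proof.
have pp : x^-1 * pospart x = pospart x^-1 by rewrite pospartV.
rewrite /orth -pp -[X in X `&` _]mul1g -mulgIl.
suff -> : 1 `&` x^-1 = (pospart x)^-1 by rewrite mulVg.
apply/le_anti/andP; split; last first.
  by rewrite lexI leinv //= -invg1 leinv.
rewrite -[X in X <= _]invgK; apply: leinv.
by rewrite leUx -{1}[x]invgK -[X in _ && (X <= _)]invg1 !leinv ?leIl ?leIr.
Qed.

(** Multiplied out, the right side is the meet of [x * x], [y * x], [x * z] and [y * z]; the first
    three are above [x]. *)
Lemma leI_mul x y z : 1 <= x -> 1 <= y -> 1 <= z ->
  x `&` (y * z) <= (x `&` y) * (x `&` z).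
Proof.
move=> x1 y1 z1; rewrite mulgIr !mulgIl.
have xl w : 1 <= w -> x <= x * w.
  by move=> w1; rewrite -{1}[x]mulg1 lemul2l.
have xr w : 1 <= w -> x <= w * x.
  by move=> w1; rewrite -{1}[x]mul1g lemul2r.
by rewrite !lexI leIr !(le_trans (leIl _ _)) ?xl ?xr.
Qed.

Lemma orthM x y z : 1 <= x -> 1 <= y -> 1 <= z ->
  orth x y -> orth x z -> orth x (y * z).
Proof.
move=> x1 y1 z1 xy xz; apply/le_anti/andP; split; last first.
  by rewrite lexI x1 mul_ge1.
by apply: le_trans (leI_mul x y z x1 y1 z1) _; rewrite xy xz mul1g.
Qed.

Lemma orthX x y n : 1 <= x -> 1 <= y -> orth x y -> orth x (y ^+ n).
Proof.
move=> x1 y1 xy; elim: n => [|n IHn]; first by rewrite expg0 /orth meet_r.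
by rewrite expgS; apply: orthM => //; apply: exp_ge1.
Qed.

Lemma orth_le_mulr x y z : 1 <= x -> 1 <= y -> 1 <= z ->
  x <= y * z -> orth x y -> x <= z.
Proof.
move=> x1 y1 z1 xyz xy; have := leI_mul x y z x1 y1 z1.
by rewrite (meet_l xyz) xy mul1g => /le_trans; apply; apply: leIr.
Qed.

Lemma orth_le_mull x y z : 1 <= x -> 1 <= y -> 1 <= z ->
  x <= y * z -> orth x z -> x <= y.
Proof.
move=> x1 y1 z1 xyz xz; have := leI_mul x y z x1 y1 z1.
by rewrite (meet_l xyz) xz mulg1 => /le_trans; apply; apply: leIr.
Qed.

(** * Archimedean groups: orthogonality survives conjugation *)

Hypothesis arch : forall x y, (forall n, x ^+ n <= y) -> x <= 1.

(* An element z below both x and y ^ c satisfies z' ^ c = z for some z' <= y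
   orthogonal to z; then z'^n <= c z^n forces z'^n <= c for all n. *)
Lemma orth_conj_ge1 x y c : 1 <= c -> 1 <= x -> 1 <= y ->
  orth x y -> orth x (y ^ c).
Proof.
move=> c1 x1 y1 xy; pose z := x `&` y ^ c; pose z' := z ^ c^-1.
have z1 : 1 <= z by rewrite lexI x1 conj_ge1.
have z'1 : 1 <= z' by rewrite conj_ge1.
have z'y : z' <= y.
  by rewrite -[y](conjgK c); apply: leconj; rewrite leIr.
have zz' : orth z z'.
  apply: (orth_le _ x) => //; first exact: leIl.
  by apply/orthC/(orth_le _ y) => //; apply: orthC.
have z'le1 : z' <= 1.
  apply: (arch _ c) => n; apply: (orth_le_mull _ _ (z ^+ n)) => //.
  - exact: exp_ge1.
  - exact: exp_ge1.
  - have <- : (z' ^+ n) ^ c = z ^+ n by rewrite conjXg conjgKV.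
    by rewrite -(conjgC (z' ^+ n) c) -{1}[z' ^+ n]mulg1 lemul2l.
  - apply: orthX => //; first exact: exp_ge1.
    by apply/orthC/orthX => //.
have : z' = 1 by apply/le_anti/andP.
by move=> /eqP; rewrite conjg_eq1 => /eqP.
Qed.

(** With [c = p * q^-1] and [p], [q] above [1], the previous lemma conjugates [y] by [p] and [x] by
    [q]; conjugating both by [q^-1] then restores [x]. *)
Lemma orth_conj x y c : 1 <= x -> 1 <= y -> orth x y -> orth x (y ^ c).
Proof.
move=> x1 y1 xy; rewrite [c]pospart_div conjgM.
have p1 := pospart_ge1 c; have q1 := pospart_ge1 c^-1.
set p := pospart c in p1 *; set q := pospart c^-1 in q1 *.
have : orth (x ^ q) (y ^ p).
  apply: orth_conj_ge1 => //; first exact: conj_ge1.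
  by apply/orthC/orth_conj_ge1 => //; apply: orthC.
by rewrite /orth => /(congr1 (fun w => w ^ q^-1)); rewrite conjI conjgK conj1g.
Qed.

(* The order of the quotient by the polar of g. *)
Definition le_on g x y := orth g (pospart (x * y^-1)).

(** * Calculus modulo a polar *)

Section LeOn.
Context {g : G} (g1 : 1 <= g).

Lemma le_onW x y : x <= y -> le_on g x y.
Proof.
move=> /(lemul2r y^-1); rewrite mulgV => xy.
by rewrite /le_on pospart_le1 // /orth meet_r.
Qed.

Lemma le_on_trans y x z : le_on g x y -> le_on g y z -> le_on g x z.
Proof.
move=> xy yz; apply: orthC.
apply: (orth_le _ (pospart (x / y) * pospart (y / z))) => //.
  by rewrite -[x / z](divgKA y); apply: pospart_leM.
by apply/orthC/orthM.
Qed.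

(** Left translation by [z] conjugates [x * y^-1] by [z^-1]: this is where polars must be normal,
    hence where [orth_conj] enters. *)
Lemma le_on_mul2l z x y : le_on g x y -> le_on g (z * x) (z * y).
Proof.
move=> /(orth_conj g _ z^-1 g1 (pospart_ge1 _)).
by rewrite pospartJ conjgE invgK /le_on invgM !mulgA.
Qed.

Lemma le_on_mul2r z x y : le_on g x y -> le_on g (x * z) (y * z).
Proof. by rewrite /le_on mulgKA. Qed.

Lemma le_on_mul x y z t : le_on g x y -> le_on g z t -> le_on g (x * z) (y * t).
Proof.
move=> xy zt; apply: (le_on_trans (y * z)); first exact: le_on_mul2r.
exact: le_on_mul2l.
Qed.

Lemma le_on_exp x y n : le_on g x y -> le_on g (x ^+ n) (y ^+ n).
Proof.
move=> xy; elim: n => [|n IHn]; first by rewrite !expg0; exact: le_onW.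
by rewrite !expgS; apply: le_on_mul.
Qed.

Lemma le_on_conj c x y : le_on g x y -> le_on g (x ^ c) (y ^ c).
Proof. by move=> xy; rewrite !conjgE; apply/le_on_mul2l/le_on_mul2r. Qed.

(** Each exchange of a [y] with an [x] to its right, on the way from the word on the left to the one
    on the right, can only enlarge it. *)
Lemma le_on_expM x y n :
  le_on g (y * x) (x * y) -> le_on g ((x * y) ^+ n) (x ^+ n * y ^+ n).
Proof.
move=> yx; have yxn k : le_on g (y * x ^+ k) (x ^+ k * y).
  elim: k => [|k IHk]; first by rewrite expg0 mulg1 mul1g; exact: le_onW.
  rewrite expgS mulgA; apply: (le_on_trans (x * y * x ^+ k)).
    exact: le_on_mul2r.
  by rewrite -!mulgA; apply: le_on_mul2l.
elim: n => [|n IHn]; first by rewrite !expg0 mul1g; exact: le_onW.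
rewrite expgS; apply: (le_on_trans (x * y * (x ^+ n * y ^+ n))).
  exact: le_on_mul2l.
rewrite [x ^+ n.+1]expgS [y ^+ n.+1]expgS -!mulgA; apply: le_on_mul2l.
by rewrite !mulgA; apply: le_on_mul2r.
Qed.

End LeOn.

Lemma le_onS h g x y : 1 <= h -> h <= g -> le_on g x y -> le_on h x y.
Proof. by move=> h1 hg gxy; apply: (orth_le _ g). Qed.

Lemma le_on_pospart h x y : 1 <= h -> h <= pospart (x / y) -> le_on h y x.
Proof.
move=> h1 hxy; apply: (orth_le _ _ _ h1 hxy) => //.
by rewrite -[y / x]invgF; apply: orth_pospartV.
Qed.

Lemma le_on_pospart_eq1 h x y : h <= pospart (x / y) -> le_on h x y -> h = 1.
Proof. by rewrite /le_on /orth => /meet_l ->. Qed.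

(* Modulo the polar of a suitable nontrivial h <= g, any two elements are
   comparable, as in a totally ordered group. *)
Lemma le_on_case x y g u v : 1 <= g ->
  (forall h, 1 <= h -> h <= g -> le_on h x y -> le_on h u v) ->
  (forall h, 1 <= h -> h <= g -> le_on h y x -> le_on h u v) -> le_on g u v.
Proof.
move=> g1 xy yx; rewrite /le_on /orth; set p := g `&` _.
have p1 : 1 <= p by rewrite lexI g1 pospart_ge1.
have pg : p <= g by exact: leIl.
have puv h : 1 <= h -> h <= p -> le_on h u v -> h = 1.
  by move=> h1 hp; apply: le_on_pospart_eq1; apply: le_trans hp (leIr _ _).
apply: (puv p) => //; apply: xy => //.
(* The goal amounts to [q = 1]. Modulo the polar of [q] the order is [y <= x], so [yx] gives
   [u <= v] there, and [puv] concludes. *)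
pose q := p `&` pospart (x / y).
have q1 : 1 <= q by rewrite lexI p1 pospart_ge1.
have qp : q <= p by exact: leIl.
apply: (puv q) => //; apply: yx => //; first exact: le_trans pg.
by apply: le_on_pospart => //; exact: leIr.
Qed.

Lemma le_on_le u v :
  (forall g, 1 <= g -> g <= pospart (u / v) -> le_on g u v) -> u <= v.
Proof.
move=> /(_ _ (pospart_ge1 _) (lexx _))/(le_on_pospart_eq1 _ _ _ (lexx _)) uv1.
by have := lemul2r v _ _ (le_pospart (u / v)); rewrite uv1 mulgVK mul1g.
Qed.

(** The Archimedean property passes to the quotient by a polar. Where [1 <= x], the powers of [k],
    the meet of [h] and [pospart x], are bounded by [pospart y] in the group itself, as the excess
    of [pospart x ^+ n] over [y] is orthogonal to [k]. *)
Lemma le_on_arch g x y : 1 <= g ->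
  (forall n, le_on g (x ^+ n) y) -> le_on g x 1.
Proof.
move=> g1 xy; apply: (le_on_case x 1) => // h h1 hg xh.
have Px : le_on h (pospart x) x.
  have -> : pospart x = x * pospart x^-1 by rewrite pospartV mulVKg.
  rewrite -[X in le_on _ _ X]mulg1; apply: le_on_mul2l => //.
  move: xh; rewrite /le_on mul1g invg1 mulg1.
  by rewrite [pospart (pospart _)]join_l ?pospart_ge1.
rewrite /le_on invg1 mulg1; set k := h `&` pospart x.
have k1 : 1 <= k by rewrite lexI h1 pospart_ge1.
suff : k <= 1 by move=> k_le1; apply/le_anti; rewrite k_le1 k1.
apply: (arch _ (pospart y)) => n.
have orthk : orth h (pospart (pospart x ^+ n / y)).
  by apply: (le_on_trans h1 (x ^+ n)); [exact: le_on_exp|exact: (le_onS h g)].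
apply: (orth_le_mulr _ (pospart (pospart x ^+ n / y))) => //.
- exact: exp_ge1.
- apply: le_trans (leexp _ _ n (leIr _ _)) _.
  rewrite -[X in X <= _](mulgVK y); exact: lemul.
- apply/orthC/orthX => //; apply/orthC.
  by apply: (orth_le _ h) => //; exact: leIl.
Qed.

(** * Archimedean lattice-ordered groups are abelian *)

(** The letter [w] covers both orders of the product, since [y] is not known to commute with
    [t ^ x]. *)
Lemma exp_conj_le x t w n : 1 <= t ->
  let y : G := pospart x * pospart x^-1 in
  w = y * (t ^ x) ^+ n \/ w = (t ^ x) ^+ n * y -> t ^+ n <= w.
Proof.
move=> t1 y wE; have y1 : 1 <= y by apply: mul_ge1.
have yx : y ^ x = y by rewrite conjMg !pospartJ conjVg !conjgE mulKg.
have c1 : 1 <= t ^ x by exact: conj_ge1.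
have cw : (t ^ x) ^+ n <= w.
  case: wE => ->; last by rewrite -{1}[_ ^+ n]mulg1 lemul2l.
  by rewrite -{1}[_ ^+ n]mul1g lemul2r.
have wy g m : 1 <= g -> le_on g (y ^+ m) ((t ^ x) ^+ n) ->
    le_on g (y ^+ m.+1) w.
  move=> g1 ym; case: wE => ->.
    by rewrite expgS; exact: le_on_mul2l.
  by rewrite expgSr; exact: le_on_mul2r.
apply: le_on_le => p p1 pE.
(* If [y ^+ m <= t ^+ n <= y ^+ m.+1] held on some [h <= p], conjugating the first inequality by
   [x], which fixes [y], would give [y ^+ m.+1 <= w], so [t ^+ n <= w] on [h] and [h = 1]. Hence on
   [p] no power of [y] overtakes [t ^+ n]. *)
have ptn m : le_on p (y ^+ m) (t ^+ n).
  elim: m => [|m IHm]; first by rewrite expg0; apply/le_onW/exp_ge1.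
  pose h := p `&` pospart (y ^+ m.+1 / t ^+ n).
  have h1 : 1 <= h by rewrite lexI p1 pospart_ge1.
  have hp : h <= p by exact: leIl.
  apply: (le_on_pospart_eq1 h (t ^+ n) w); first exact: le_trans pE.
  apply: (le_on_trans h1 (y ^+ m.+1)).
    by apply: le_on_pospart => //; exact: leIr.
  apply: wy => //; rewrite -yx -!conjXg; apply: le_on_conj => //.
  exact: (le_onS h p).
(* Now [y <= 1] on [p], so [x] is trivial modulo the polar and [t] agrees there with its
   conjugate. *)
have py := le_on_arch p y _ p1 ptn.
have px : le_on p 1 x^-1.
  rewrite -(mulVg x) -[X in le_on _ _ X]mulg1; apply: le_on_mul2l => //.
  apply: le_on_trans py => //; apply: le_onW => //.
  by rewrite -[x]mulg1; apply: lemul.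
have pVx : le_on p 1 x.
  rewrite -{1}(mulgV x) -[X in le_on _ _ X]mulg1; apply: le_on_mul2l => //.
  apply: le_on_trans py => //; apply: le_onW => //.
  by rewrite -[x^-1]mul1g; apply: lemul.
apply: (le_on_trans p1 ((t ^ x) ^+ n)); last exact: le_onW.
apply: le_on_exp => //; rewrite conjgE -{1}[t]mul1g -{1}[t]mulg1.
by do 2!apply: le_on_mul => //; apply: le_onW.
Qed.

Lemma conj_ge x t : 1 <= t -> t <= t ^ x.
Proof.
move=> t1; set c := t ^ x; pose y : G := pospart x * pospart x^-1.
have t_yc n : t ^+ n <= y * c ^+ n by apply: exp_conj_le => //; left.
have t_cy n : t ^+ n <= c ^+ n * y by apply: exp_conj_le => //; right.
(* From here on [c] matters only through the two bounds just proved. *)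
clearbody c.
apply: le_on_le => g g1 _.
apply: (le_on_case (t * c) (c * t)) => // h h1 _ tc.
  suff /(le_on_mul2r c) : le_on h (t * c^-1) 1 by rewrite mulgVK mul1g.
  apply: (le_on_arch _ _ y) => // n.
  apply: (le_on_trans h1 (t ^+ n * c^-1 ^+ n)).
    apply: le_on_expM => //.
    move: tc => /(le_on_mul2l h1 c^-1)/(le_on_mul2r c^-1).
    by rewrite !mulgA mulVg mul1g mulgK.
  by rewrite expVgn; apply: le_onW => //; rewrite -[y](mulgK (c ^+ n)) lemul2r.
suff /(le_on_mul2l h1 c) : le_on h (c^-1 * t) 1 by rewrite mulVKg mulg1.
apply: (le_on_arch _ _ y) => // n.
apply: (le_on_trans h1 (c^-1 ^+ n * t ^+ n)).
  apply: le_on_expM => //.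
  move: tc => /(le_on_mul2l h1 c^-1)/(le_on_mul2r c^-1).
  by rewrite !mulgA mulVg mul1g mulgK.
by rewrite expVgn; apply: le_onW => //; rewrite -[y](mulKg (c ^+ n)) lemul2l.
Qed.

(** Applying [conj_ge] to [y] and to [y^-1] shows that conjugation by [y] fixes every [t >= 1];
    every [x] is a quotient of two such elements. *)
Lemma archimedean_commute x y : commute x y.
Proof.
have comm1 t : 1 <= t -> commute t y.
  move=> t1; rewrite /commute conjgC; congr (_ * _).
  apply/le_anti/andP; split; last exact: conj_ge.
  by rewrite -[X in _ <= X](conjgKV y); apply: leconj; apply: conj_ge.
rewrite [x]pospart_div; apply/commute_sym/commuteM.
  exact/commute_sym/comm1.
exact/commuteV/commute_sym/comm1.
Qed.

End LGroupTheory.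

(** * The nonzero scalars as an Archimedean lattice-ordered group *)

Section NonzeroGroup.
Context {K : bcSemifieldType}.
Implicit Types a b c : K.
Local Open Scope ring_scope.

Lemma nle_add2 a b c d : a <=+ b -> c <=+ d -> a + c <=+ b + d.
Proof. by rewrite /nle addrACA => /eqP -> /eqP ->. Qed.

Lemma nle_addl a b : a <=+ a + b.
Proof. by rewrite /nle addrA addxx. Qed.

Lemma nle_addr a b : b <=+ a + b.
Proof. by rewrite addrC nle_addl. Qed.

Lemma add_nle a b c : a <=+ c -> b <=+ c -> a + b <=+ c.
Proof. by move=> ac bc; rewrite -[c]addxx nle_add2. Qed.

Lemma nle_mul2l c a b : a <=+ b -> c * a <=+ c * b.
Proof. by rewrite /nle -mulrDr => /eqP ->. Qed.

Lemma nle_mul2r c a b : a <=+ b -> a * c <=+ b * c.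
Proof. by rewrite /nle -mulrDl => /eqP ->. Qed.

Lemma nlex0 a : a <=+ 0 -> a = 0.
Proof. by rewrite /nle addr0 => /eqP. Qed.

Lemma addr_neq0 a b : a != 0 -> a + b != 0.
Proof.
by apply: contra_neq => ab0; apply: nlex0; rewrite -ab0 nle_addl.
Qed.

Lemma smulr_neq0 a b : a != 0 -> b != 0 -> a * b != 0.
Proof.
move=> a0; apply: contra_neq => ab0.
by rewrite -[b]mul1r -(mulVs a a0) -mulrA ab0 mulr0.
Qed.

Lemma sinv_neq0 a : (1 : K) != 0 -> a != 0 -> sinv a != 0.
Proof.
move=> K1 a0; apply: contra_neq K1 => sa0.
by rewrite -(mulVs a a0) sa0 mul0r.
Qed.

(* The argument K1 is what provides the unit of the group structure below. *)
Definition nonzero (K1 : (1 : K) != 0) := {a : K | a != 0}.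

Section Instances.
Context (K1 : (1 : K) != 0).
Notation G := (nonzero K1).

HB.instance Definition _ := SubType.copy G {a : K | a != 0}.
HB.instance Definition _ := Choice.copy G {a : K | a != 0}.

Definition nzmul (x y : G) : G :=
  exist _ (val x * val y) (smulr_neq0 _ _ (valP x) (valP y)).
Definition nzone : G := exist _ 1 K1.
Definition nzinv (x : G) : G :=
  exist _ (sinv (val x)) (sinv_neq0 _ K1 (valP x)).
Definition nzle (x y : G) := val x <=+ val y.
Definition nzjoin (x y : G) : G :=
  exist _ (val x + val y) (addr_neq0 _ _ (valP x)).
(** Inversion reverses the order, so the meet is dual to the join, which is the sum. *)
Definition nzmeet (x y : G) := nzinv (nzjoin (nzinv x) (nzinv y)).

Fact nzmulA : associative nzmul.
Proof. by move=> x y z; apply: val_inj; apply: mulrA. Qed.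
Fact nzmul1 : left_id nzone nzmul.
Proof. by move=> x; apply: val_inj; apply: mul1r. Qed.
Fact nzmulr1 : right_id nzone nzmul.
Proof. by move=> x; apply: val_inj; apply: mulr1. Qed.
Fact nzmulV : left_inverse nzone nzinv nzmul.
Proof. by move=> x; apply: val_inj; exact: mulVs (valP x). Qed.
Fact nzmulrV : right_inverse nzone nzinv nzmul.
Proof. by move=> x; apply: val_inj; exact: mulsV (valP x). Qed.

HB.instance Definition _ :=
  isGroup.Build G nzmulA nzmul1 nzmulr1 nzmulV nzmulrV.

Fact nzle_refl : reflexive nzle.
Proof. by move=> x; apply: nle_refl. Qed.
Fact nzle_anti : antisymmetric nzle.
Proof. by move=> x y xy; apply/val_inj/nle_anti. Qed.
Fact nzle_trans : transitive nzle.
Proof. by move=> y x z; apply: nle_trans. Qed.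

HB.instance Definition _ := Order.Le_isPOrder.Build ring_display G
  nzle_refl nzle_anti nzle_trans.

Fact nzleV (x y : G) : nzle x y -> nzle (nzinv y) (nzinv x).
Proof.
move=> /(nle_mul2l (val (nzinv x)))/(nle_mul2r (val (nzinv y))).
by rewrite /nzle /= (mulVs _ (valP x)) mul1r -mulrA (mulsV _ (valP y)) mulr1.
Qed.
Fact nzjoinP (x y z : G) : nzle (nzjoin x y) z = nzle x z && nzle y z.
Proof.
apply/idP/andP => [xyz|[]]; last exact: add_nle.
by split; apply: nle_trans xyz; [exact: nle_addl|exact: nle_addr].
Qed.
Fact nzmeetP (x y z : G) : nzle x (nzmeet y z) = nzle x y && nzle x z.
Proof.
have invK (u : G) : nzinv (nzinv u) = u by exact: (@invgK G u).
have leV (u v : G) : nzle u v = nzle (nzinv v) (nzinv u).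
  by apply/idP/idP => /nzleV //; rewrite !invK.
by rewrite leV [nzle x y]leV [nzle x z]leV /nzmeet invK nzjoinP.
Qed.

HB.instance Definition _ :=
  Order.POrder_MeetJoin_isLattice.Build ring_display G nzmeetP nzjoinP.

Fact nzmul_le2l (z x y : G) : (x <= y)%O -> (z * x <= z * y)%O%g.
Proof. exact: nle_mul2l. Qed.
Fact nzmul_le2r (z x y : G) : (x <= y)%O -> (x * z <= y * z)%O%g.
Proof. exact: nle_mul2r. Qed.

HB.instance Definition _ :=
  isTranslationInvariant.Build ring_display G nzmul_le2l nzmul_le2r.

(* With s the supremum of the powers of x, x s is the supremum of the same
   powers except 1, so x s <= s. *)
Lemma nonzero_archimedean (x y : G) : (forall n, (x ^+ n)%g <= y) -> x <= 1%g.
Proof.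
move=> xy; pose A : set K := [set val (x ^+ n)%g | n in [set: nat]]%classic.
have [|s sA] := @bcomplete K A.
  by exists (val y) => _ [n _ <-]; exact: xy.
have As n : val (x ^+ n)%g <=+ s by apply: sA.1; exists n.
have s0 : s != 0.
  by apply: contra_neq K1 => s0; apply: nlex0; rewrite -s0; exact: (As 0%N).
have xs : val x * s <=+ s.
  apply: (mul_supr (val x) s A sA).2 => _ [_ [n _ <-] <-].
  by move: (As n.+1); rewrite expgS.
have := nle_mul2r (sinv s) _ _ xs.
by rewrite -mulrA mulsV // mulr1.
Qed.

End Instances.

Lemma semifield_mulC : commutative (@GRing.mul K).
Proof.
(* If [1 = 0] the semifield is trivial and has no group of nonzero elements. *)
have [K1|K1 a b] := eqVneq (1 : K) 0.
  by move=> a b; rewrite -[a * b]mulr1 -[b * a]mulr1 K1 !mulr0.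
have [->|a0] := eqVneq a 0; first by rewrite mulr0 mul0r.
have [->|b0] := eqVneq b 0; first by rewrite mulr0 mul0r.
pose x : nonzero K1 := exist _ a a0; pose y : nonzero K1 := exist _ b b0.
by have := archimedean_commute (nonzero_archimedean K1) x y => /(congr1 val).
Qed.

End NonzeroGroup.

(** * Suprema, products and residuation in the enlargement *)

Section Enlarged.
Context {K : bcSemifieldType}.
Implicit Types (a b c d : enlarged K) (A B : set (enlarged K)).
Local Open Scope ring_scope.
Local Open Scope classical_set_scope.

Lemma le_Top a : a <= Top.
Proof. by case: a. Qed.

Lemma le0_enlarged a : Fin 0 <= a.
Proof. by case: a => // x; exact: bc_le0x. Qed.

(** Either [Top] is the only upper bound, or a finite one exists and b-completeness applies to the
    finite members of [A]. *)
Lemma enlarged_supremums_neq0 A : supremums A !=set0.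
Proof.
have TopP : ubound A Top by move=> a _; exact: le_Top.
have [|nbA] := pselect (exists m, ubound A (Fin m)); last first.
  by exists Top; split=> // -[m|//] mA; case: nbA; exists m.
case=> m mA; pose L : set K := [set x | A (Fin x)].
have [|s [sL sle]] := @bcomplete K L; first by exists m => x /mA.
exists (Fin s); split=> [[x|]|[n|] nA //].
- exact: sL.
- by move=> /mA.
- by apply: (sle n) => x /nA.
Qed.

(** The default [Fin 0] of [esup] is the least element, hence correct on the empty set. *)
Lemma esup_supremums A : supremums A (esup A).
Proof.
rewrite /esup /supremum; case: eqVneq => [->|_].
  by split=> // a _; exact: le0_enlarged.
by have [s sA] := enlarged_supremums_neq0 A; case: xgetP => // /(_ s).
Qed.

Lemma einf_supremums A : infimums A (einf A).
Proof.
rewrite /einf /infimum; case: eqVneq => [->|_].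
  by split=> // a _; exact: le_Top.
have [s [ls sl]] := enlarged_supremums_neq0 (lbound A).
have sA : infimums A s.
  by split=> // a Aa; apply: sl => b; apply.
by case: xgetP => // /(_ s).
Qed.

Lemma einf_pair_Top a : einf [set a; Top] = a.
Proof.
have [lA Al] := einf_supremums [set a; Top].
apply/le_anti/andP; split; first by apply: lA; left.
by apply: Al => b [->|->]; rewrite ?le_Top.
Qed.

Lemma emulC : commutative (@emul K).
Proof. by case=> [x|] [y|] //=; rewrite semifield_mulC. Qed.

Lemma emul_le2l c a b : a <= b -> emul c a <= emul c b.
Proof.
case: c a b => [z|] [x|] [y|] //=.
- exact: nle_mul2l.
- by case: eqVneq => // -> _; rewrite mul0r; exact: bc_le0x.
- case: (eqVneq x) => [_|x0]; first by rewrite le0_enlarged.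
  by case: (eqVneq y) => [->|//] /nlex0 x0'; rewrite x0' eqxx in x0.
- by move=> _; exact: le_Top.
Qed.

Lemma esup_fin (L : set K) (s : K) : nsup L s ->
  esup [set Fin x | x in L] = Fin s.
Proof.
move=> [sL Ls]; have [eL Le] := esup_supremums [set Fin x | x in L].
apply/le_anti/andP; split.
  by apply: Le => _ [x Lx <-]; exact: sL.
case: esup eL => [e|] // eL; apply: Ls => x Lx.
by apply: (eL (Fin x)); exists x.
Qed.

Hypothesis K_no_greatest : ~ exists m : K, forall x : K, x <=+ m.

Lemma esup_fin_setT (L : set K) : (forall x, L x) ->
  esup [set Fin x | x in L] = Top.
Proof.
move=> LT; have [eL _] := esup_supremums [set Fin x | x in L].
case: esup eL => [e|] // eL; case: K_no_greatest; exists e => x.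
by apply: (eL (Fin x)); exists x.
Qed.

(** Although [eresid] ranges over finite scalars only, the adjunction holds for [a = Top] too: when
    all finite scalars qualify, the absence of a greatest one makes their supremum [Top]. Otherwise
    the residual is [0] for [b = Top], and [sinv z * w] for [b = Fin z] with [z] nonzero. *)
Lemma eresidP a b c : (a <= eresid c b) = (emul b a <= c).
Proof.
have eresidT : (forall x, emul b (Fin x) <= c) -> eresid c b = Top.
  exact: esup_fin_setT.
have eresidF s : emul b (Fin s) <= c ->
    (forall x, emul b (Fin x) <= c -> x <=+ s) -> eresid c b = Fin s.
  by move=> bs sb; apply: esup_fin; split=> [x /sb|t]; last exact.
case: c => [w|] in eresidT eresidF *; last first.
  by rewrite eresidT ?le_Top // => x; exact: le_Top.
case: b => [z|] in eresidT eresidF *; last first.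
  rewrite (eresidF 0) /= ?eqxx; last first.
  - by move=> x; case: eqVneq => // -> _; exact: bc_le0x.
  - exact: le0_enlarged.
  case: a => [x|] //=; case: eqVneq => [->|x0]; first by rewrite !le0_enlarged.
  by apply/negbTE; apply: contra x0 => /nlex0 ->.
have [z0|z0] := eqVneq z 0.
  rewrite eresidT => [|x]; rewrite ?z0.
    by rewrite le_Top; case: a => [x|] /=; rewrite ?eqxx ?mul0r le0_enlarged.
  by rewrite /= mul0r le0_enlarged.
have zP x : (z * x <=+ w) = (x <=+ sinv z * w).
  apply/idP/idP => [/(nle_mul2l (sinv z))|/(nle_mul2l z)].
    by rewrite mulrA mulVs // mul1r.
  by rewrite mulrA mulsV // mul1r.
rewrite (eresidF (sinv z * w)).
- by case: a => [x|] /=; [exact/esym/zP | rewrite (negbTE z0)].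
- by rewrite /= [_ <= _]zP; exact: nle_refl.
- by move=> x; rewrite /= [_ <= _]zP.
Qed.

End Enlarged.

(** * Residuation in the semimodule *)

Section Residuation.
Context {K : bcSemifieldType} {X : bcSemimodType K}.
Local Open Scope ring_scope.
Local Open Scope classical_set_scope.
Hypothesis A1 : residuals_bounded X.
Implicit Types (x y : X) (l : K).

Lemma le_resid x y l : l *: y <=+ x -> Fin l <= resid x y.
Proof. by move=> lyx; apply: (esup_supremums _).1; exists l. Qed.

(** The supremum [s] exists by (A1); as the action distributes over it, [s *: y] is the supremum of
    vectors below [x]. *)
Lemma resid_attained x y : y != 0 ->
  exists2 l, resid x y = Fin l & l *: y <=+ x.
Proof.
move=> y0.
have [s sL] := bcomplete [set l : addorder K | l *: y <=+ x] (A1 x y y0).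
exists s; first exact: esup_fin.
by apply: (scale_supl s y _ sL).2 => _ [l lyx <-].
Qed.

Lemma elementary_Top x y : elementary y Top x = resid x y.
Proof. exact: einf_pair_Top. Qed.

Lemma elementary_le x y d : elementary y d x <= resid x y.
Proof. by apply: (einf_supremums _).1; left. Qed.

End Residuation.

(** * The cycle of implications *)

Local Open Scope ring_scope.

Theorem theorem23 (K : bcSemifieldType) (X : bcSemimodType K)
    (K_no_greatest : ~ exists m : K, forall a : K, a <=+ m)
    (A1 : residuals_bounded X) (f : X -> enlarged K) :
  [<-> anti_topical f;
       f 0 = Top /\
         (forall x y : X, emul (f x) (resid x y) <= f y);
       f 0 = Top /\
         (forall (x y : X) (d : enlarged K),
            emul (f x) (elementary y d x) <= f y);
       f 0 = Top /\
         (forall x y : X, f x <= eresid (f y) (resid x y))].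
Proof.
tfae.
- move=> [fdec fhom]; have f0 : f 0 = Top.
    by rewrite -(scale0r (0 : X)) fhom /= eqxx.
  split=> // x y; have [->|y0] := eqVneq y 0; first by rewrite f0 le_Top.
  have [l -> lyx] := resid_attained A1 x y y0.
  (* For [l = 0] anti-homogeneity says nothing about [f y], but the product to bound is then
     [Fin 0]. *)
  have [->|l0] := eqVneq l 0.
    by case: (f x) => [a|] /=; rewrite ?eqxx ?mulr0 le0_enlarged.
  have := fdec _ _ lyx; rewrite fhom /= (negbTE l0).
  case: (f y) => [b|]; last by rewrite !le_Top.
  case: (f x) => [a|] //= /(nle_mul2l l).
  by rewrite mulrA mulsV // mul1r semifield_mulC.
- move=> [f0 fle]; split=> // x y d.
  exact: le_trans (emul_le2l _ _ _ (elementary_le x y d)) (fle x y).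
- move=> [f0 fle]; split=> // x y.
  (* The choice [d = Top] turns [elementary y d] into the residual. *)
  by rewrite eresidP // emulC -(elementary_Top x y).
- move=> [f0 fle']; have fle l x y : l *: y <=+ x -> emul (f x) (Fin l) <= f y.
    move=> /le_resid/(emul_le2l (f x)) /le_trans; apply.
    by rewrite emulC -eresidP.
  split=> [x y xy|l x].
    have := fle 1 y x; rewrite scale1r => /(_ xy).
    case: (f y) => [b|] /=; first by rewrite mulr1.
    (* With [1 = 0] the only scalar [0] would be a greatest element. *)
    case: eqVneq => // K1 _.
    by case: K_no_greatest; exists 0 => a; rewrite -[a]mulr1 K1 mulr0 nle_refl.
  have [->|l0] := eqVneq l 0; first by rewrite scale0r f0 /= eqxx.
  have K1 : (1 : K) != 0.
    by apply: contra_neq l0 => K1; rewrite -[l]mulr1 K1 mulr0.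
  (* Anti-homogeneity comes from two opposite bounds: [l *: x] against [x] with scalar [l], and [x]
     against [l *: x] with scalar [sinv l]. *)
  have := fle l (l *: x) x (nle_refl _).
  have := fle (sinv l) x (l *: x).
  rewrite scalerA mulVs // scale1r => /(_ (nle_refl _)).
  rewrite /= (negbTE l0).
  case: (f x) (f (l *: x)) => [a|] [b|] //=; rewrite ?(negbTE l0) //.
    move=> ab ba; congr Fin; apply/nle_anti/andP; split.
      move: ba => /(nle_mul2l (sinv l)).
      by rewrite semifield_mulC -mulrA mulsV // mulr1.
    by rewrite semifield_mulC.
  by rewrite (negbTE (sinv_neq0 _ K1 l0)).
Qed.
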